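(* Let $M$ be an $R$-module. (1) Let $N_{1}$ and $N_{2}$ be gsdf-absorbing submodules of $M$ such that $\sqrt{(N_{1}:_{R}x)}=\sqrt{(N_{2}:_{R}x)}$ for all $x\in M\setminus(N_{1}\cap N_{2})$. Then $N_{1}\cap N_{2}$ is a gsdf-absorbing submodule of $M$. (2) Let $\{N_{i}\}_{i\in I}$ be a directed family of gsdf-absorbing submodules of $M$. Then the union $N=\bigcup_{i\in I}N_{i}$ is a gsdf-absorbing submodule of $M$.
   Context: All rings are commutative with identity $1\neq 0$ and all modules are unital. Let $R$ be a ring and $M$ an $R$-module. A proper submodule $N$ of $M$ is called a generalized square-difference factor absorbing submodule (gsdf-absorbing submodule) if for all $u,v\in R$ and $x\in M$, the condition $(u^{2}-v^{2})x\in N$ implies that $(u-v)x\in N$ or $(u+v)^{k}x\in N$ for some positive integer $k$. For a submodule $N$ of $M$ and $x\in M$, $(N:_{R}x)=\{r\in R\mid rx\in N\}$; for an ideal $I$ of $R$, $\sqrt{I}=\{u\in R\mid u^{n}\in I\text{ for some positive integer }n\}$. A family of submodules is directed if any two members are both contained in some member of the family.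
   Formalization: In (2) the directed family is assumed nonempty and the union is shown gsdf-absorbing only when it is a proper submodule of M: a directed union of proper submodules can be all of M (e.g. polynomials of degree < i in Q[X] over Q), where the printed claim fails. *)

(* Defs.v *)
From mathcomp Require Import all_boot all_order all_algebra.
From mathcomp Require Import boolp classical_sets.

Set Implicit Arguments.
Unset Strict Implicit.
Unset Printing Implicit Defensive.

Import GRing.Theory.
Local Open Scope classical_set_scope.
Local Open Scope ring_scope.

Definition submodule (R : comNzRingType) (M : lmodType R) (N : set M) : Prop :=
  GRing.submod_closed (mem N).

Definition gsdf_absorbing (R : comNzRingType) (M : lmodType R) (N : set M) :
    Prop :=
  [/\ submodule N,
      N `<` [set: M] &
      forall (u v : R) (x : M), N ((u ^+ 2 - v ^+ 2) *: x) ->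
        N ((u - v) *: x) \/ exists2 k : nat, (0 < k)%N & N ((u + v) ^+ k *: x)].

Definition colon (R : comNzRingType) (M : lmodType R) (N : set M) (x : M) :
    set R :=
  [set r | N (r *: x)].

Definition radical (R : comNzRingType) (J : set R) : set R :=
  [set u | exists2 n : nat, (0 < n)%N & J (u ^+ n)].

Definition directed (T I : Type) (N : I -> set T) : Prop :=
  forall i j : I, exists k : I, N i `<=` N k /\ N j `<=` N k.

(* Main.v *)
Require Import Defs.
From mathcomp Require Import all_boot all_order all_algebra.
From mathcomp Require Import boolp classical_sets.

Local Open Scope classical_set_scope.
Local Open Scope ring_scope.

Import GRing.Theory.

(** For an intersection, the danger is that [N1] yields the alternative on [u - v] while [N2] yields
    the one on [u + v]. The second alternative says that [u + v] lies in the radical of the colon at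
    [x]; equality of the two radicals carries it to the other submodule, and [radical_colonI] finds
    a common exponent. For a union, the premise concerns a single element, hence a single member,
    whose conclusion passes to the union; directedness serves closure under addition
    ([submodule_bigcup]). *)

Lemma submoduleE (R : comNzRingType) (M : lmodType R) (N : set M) :
  submodule N <-> N 0 /\ forall (a : R) (x y : M), N x -> N y -> N (a *: x + y).
Proof.
split=> [[N0 ND]|[N0 ND]].
  split=> [|a x y Nx Ny]; first exact: set_mem N0.
  by apply: set_mem; apply: ND; exact: mem_set.
split=> [|a x y /set_mem Nx /set_mem Ny]; first exact: mem_set.
by apply: mem_set; exact: ND.
Qed.

Lemma submoduleZ (R : comNzRingType) (M : lmodType R) (N : set M) (a : R)
  (x : M) : submodule N -> N x -> N (a *: x).
Proof. by move=> /submoduleE[N0 ND] Nx; rewrite -[_ *: _]addr0; exact: ND. Qed.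

Lemma submoduleI (R : comNzRingType) (M : lmodType R) (N1 N2 : set M) :
  submodule N1 -> submodule N2 -> submodule (N1 `&` N2).
Proof.
move=> /submoduleE[N10 N1D] /submoduleE[N20 N2D]; apply/submoduleE.
by split=> // a x y [? ?] [? ?]; split; [exact: N1D | exact: N2D].
Qed.

Lemma submodule_bigcup (R : comNzRingType) (M : lmodType R) (I : Type)
  (N : I -> set M) :
  inhabited I -> directed N -> (forall i, submodule (N i)) ->
  submodule (\bigcup_(i in [set: I]) N i).
Proof.
move=> [i0] dirN subN; apply/submoduleE; split=> [|a x y [i _ Nix] [j _ Njy]].
  by exists i0 => //; have /submoduleE[] := subN i0.
(* Directedness puts both summands in one member. *)
have [k [Nik Njk]] := dirN i j; exists k => //.
by have /submoduleE[_] := subN k; apply; [exact: Nik | exact: Njk].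
Qed.

(** If [w ^+ k] works for [N1] and [w ^+ l] for [N2], then [w ^+ (k + l)] is a multiple of both. *)
Lemma radical_colonI (R : comNzRingType) (M : lmodType R) (N1 N2 : set M)
  (x : M) : submodule N1 -> submodule N2 ->
  radical (colon N1 x) `&` radical (colon N2 x) `<=`
  radical (colon (N1 `&` N2) x).
Proof.
move=> sub1 sub2 w [[k k_gt0 N1k] [l l_gt0 N2l]].
exists (k + l)%N; first by rewrite addn_gt0 k_gt0.
split; first by rewrite addnC exprD -scalerA; exact: submoduleZ.
by rewrite exprD -scalerA; exact: submoduleZ.
Qed.

Lemma gsdf_absorbingI (R : comNzRingType) (M : lmodType R) (N1 N2 : set M) :
  gsdf_absorbing N1 -> gsdf_absorbing N2 ->
  (forall x : M, ~ (N1 `&` N2) x ->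
     radical (colon N1 x) = radical (colon N2 x)) ->
  gsdf_absorbing (N1 `&` N2).
Proof.
move=> [sub1 [_ prop1] abs1] [sub2 _ abs2] rad12.
have sub12 : submodule (N1 `&` N2) by exact: submoduleI.
split=> //; first by split=> // TN; apply: prop1 => x /TN[].
move=> u v x [N1x N2x].
(* The radicals are known to agree only at [x] outside the intersection; inside it, every multiple
   of [x] stays there. *)
have [Nx|/rad12 radE] := pselect ((N1 `&` N2) x).
  by left; exact: submoduleZ.
(* A power of [u + v] from either submodule suffices; otherwise both contain [(u - v) *: x]. *)
have [uv1|rad1] := abs1 u v x N1x; last first.
  by right; apply: radical_colonI => //; split; rewrite -?radE.
have [uv2|rad2] := abs2 u v x N2x; first by left.
by right; apply: radical_colonI => //; split; rewrite ?radE.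
Qed.

(** Properness is a hypothesis because an increasing union of proper submodules can be all of [M],
    as with subspaces of an infinite-dimensional vector space. *)
Lemma gsdf_absorbing_bigcup (R : comNzRingType) (M : lmodType R) (I : Type)
  (N : I -> set M) :
  submodule (\bigcup_(i in [set: I]) N i) ->
  \bigcup_(i in [set: I]) N i `<` [set: M] ->
  (forall i, gsdf_absorbing (N i)) ->
  gsdf_absorbing (\bigcup_(i in [set: I]) N i).
Proof.
move=> subN propN absN; split=> // u v x [i _ Nix].
have [_ _ absNi] := absN i.
have [uvx|[k k_gt0 uvx]] := absNi u v x Nix; first by left; exists i.
by right; exists k => //; exists i.
Qed.

Theorem proposition3p5 (R : comNzRingType) (M : lmodType R) :
  (forall N1 N2 : set M,
      gsdf_absorbing N1 -> gsdf_absorbing N2 ->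
      (forall x : M, ~ (N1 `&` N2) x ->
         radical (colon N1 x) = radical (colon N2 x)) ->
      gsdf_absorbing (N1 `&` N2))
  /\
  (forall (I : Type) (N : I -> set M),
      inhabited I ->
      directed N ->
      (forall i : I, gsdf_absorbing (N i)) ->
      submodule (\bigcup_(i in [set: I]) N i) /\
      (\bigcup_(i in [set: I]) N i `<` [set: M] ->
       gsdf_absorbing (\bigcup_(i in [set: I]) N i))).
Proof.
split=> [N1 N2|I N inhI dirN absN]; first exact: gsdf_absorbingI.
have subN : submodule (\bigcup_(i in [set: I]) N i).
  by apply: submodule_bigcup => // i; have [] := absN i.
by split=> // propN; exact: gsdf_absorbing_bigcup.
Qed.
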